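(* Let $(\mathcal C,\mathbb E,\mathfrak s)$ be an extriangulated category satisfying Condition (WIC), and let $\xi$ be a proper class of $\mathbb E$-triangles such that $\mathcal C$ has enough $\xi$-projectives and enough $\xi$-injectives. Then every object of $\mathcal C$ possesses a $\xi$-injective envelope if and only if every object of $\mathcal C$ possesses a quasi-$\xi$-injective envelope.
   Context: Extriangulated categories (Nakaoka–Palu). $\mathcal C$ is an additive category with a biadditive functor $\mathbb E:\mathcal C^{op}\times\mathcal C\to\mathbf{Ab}$. An element $\delta\in\mathbb E(C,A)$ is an $\mathbb E$-extension; write $a_*\delta=\mathbb E(C,a)(\delta)$ and $c^*\delta=\mathbb E(c,A)(\delta)$. A morphism $(a,c):\delta\to\delta'$ from $\delta\in\mathbb E(C,A)$ to $\delta'\in\mathbb E(C',A')$ is a pair $a:A\to A'$, $c:C\to C'$ with $a_*\delta=c^*\delta'$. Sequences $A\to B\to C$ and $A\to B'\to C$ are equivalent if there is an isomorphism $B\to B'$ compatible with $1_A,1_C$. A realization $\mathfrak s$ assigns to each $\delta\in\mathbb E(C,A)$ an equivalence class $[A\xrightarrow{x}B\xrightarrow{y}C]$ such that every morphism $(a,c)$ of extensions extends to a commutative $(a,b,c)$ between the realizing sequences; it is additive if $\mathfrak s(0)=[A\to A\oplus C\to C]$ and $\mathfrak s(\delta\oplus\delta')=\mathfrak s(\delta)\oplus\mathfrak s(\delta')$. The triple is extriangulated if: (ET1) $\mathbb E$ is biadditive; (ET2) $\mathfrak s$ is an additive realization; (ET3) if $A\xrightarrow{x}B\xrightarrow{y}C$,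 $A'\xrightarrow{x'}B'\xrightarrow{y'}C'$ realize $\delta,\delta'$ and $bx=x'a$, then there is $c$ with $cy=y'b$ and $a_*\delta=c^*\delta'$; (ET3)$^{op}$ the dual; (ET4) if $A\xrightarrow{f}B\xrightarrow{f'}D$ realizes $\delta$ and $B\xrightarrow{g}C\xrightarrow{g'}F$ realizes $\delta'$, there are an object $E$, morphisms $h=gf$, $h':C\to E$, $d:D\to E$, $e:E\to F$ with $h'g=df'$, $eh'=g'$, and $\delta''\in\mathbb E(E,A)$ realized by $A\xrightarrow{h}C\xrightarrow{h'}E$, such that $D\xrightarrow{d}E\xrightarrow{e}F$ realizes $f'_*\delta'$, $d^*\delta''=\delta$, $f_*\delta''=e^*\delta'$; (ET4)$^{op}$ the dual. If $A\xrightarrow{x}B\xrightarrow{y}C$ realizes $\delta$, then $x$ is called an inflation, $y$ a deflation, and $A\xrightarrow{x}B\xrightarrow{y}C\overset{\delta}{\dashrightarrow}$ an $\mathbb E$-triangle; it is split if $\delta=0$. Condition (WIC): if $gf$ is an inflation then so is $f$; if $gf$ is a deflation then so is $g$. Proper class. A class $\xi$ of $\mathbb E$-triangles closed under isomorphisms is proper if: (1) it is closed under finite coproducts and contains all split $\mathbb E$-triangles; (2) it is closed under base change (triangles realizing $c^*\delta$) and cobase change (triangles realizing $a_*\delta$); (3) it is saturated: given $\mathbb E$-triangles $A_i\to B_i\xrightarrow{y_i}C\overset{\delta_i}{\dashrightarrow}$ ($i=1,2$), if the second one and the $\mathbb E$-triangle $A_1\to M\to B_2\overset{y_2^*\delta_1}{\dashrightarrow}$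 are in $\xi$, then the first one is in $\xi$. In an $\mathbb E$-triangle $A\xrightarrow{x}B\xrightarrow{y}C\dashrightarrow$ in $\xi$, $x$ is called a $\xi$-inflation and $y$ a $\xi$-deflation. $I$ is $\xi$-injective if for each $\mathbb E$-triangle $A\to B\to C\dashrightarrow$ in $\xi$ the sequence $0\to\mathcal C(C,I)\to\mathcal C(B,I)\to\mathcal C(A,I)\to0$ is exact; $\xi$-projective is dual. Enough $\xi$-injectives: for each $A$ there is $A\to I\to K\dashrightarrow$ in $\xi$ with $I$ $\xi$-injective; enough $\xi$-projectives is dual. $Q$ is quasi-$\xi$-injective if for each $\mathbb E$-triangle $A\to Q\to B\dashrightarrow$ in $\xi$ (with middle term $Q$) the sequence $0\to\mathcal C(B,Q)\to\mathcal C(Q,Q)\to\mathcal C(A,Q)\to0$ is exact. A $\xi$-inflation $f:A\to B$ is essential if every morphism $g:B\to C$ such that $gf$ is a $\xi$-inflation is itself a $\xi$-inflation. A $\xi$-injective envelope (resp. quasi-$\xi$-injective envelope) of $A$ is an essential $\xi$-inflation $f:A\to X$ with $X$ $\xi$-injective (resp. quasi-$\xi$-injective). *)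

(* Defs.v *)
From mathcomp Require Import all_boot ssralg.

Set Implicit Arguments.
Unset Strict Implicit.
Unset Printing Implicit Defensive.

Import GRing.Theory.
Local Open Scope ring_scope.

(** * Additive categories *)

Declare Scope cat_scope.
Delimit Scope cat_scope with cat.
Reserved Notation "g \oc f" (at level 40, left associativity).

(* Morphism sets are abelian groups; the zero object and the binary biproducts
   are part of the data. *)
Record addCat := AddCat {
  Ob :> Type;
  Mor : Ob -> Ob -> zmodType;
  idm : forall A : Ob, Mor A A;
  compm : forall A B C : Ob, Mor B C -> Mor A B -> Mor A C
    where "g \oc f" := (compm g f);
  comp1m : forall (A B : Ob) (f : Mor A B), idm B \oc f = f;
  compm1 : forall (A B : Ob) (f : Mor A B), f \oc idm A = f;
  compmA : forall (A B C D : Ob)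
    (h : Mor C D) (g : Mor B C) (f : Mor A B),
    h \oc (g \oc f) = (h \oc g) \oc f;
  compmDl : forall (A B C : Ob) (g g' : Mor B C) (f : Mor A B),
    (g + g') \oc f = g \oc f + g' \oc f;
  compmDr : forall (A B C : Ob) (g : Mor B C) (f f' : Mor A B),
    g \oc (f + f') = g \oc f + g \oc f';
  zob : Ob;
  zob_initial : forall (A : Ob) (f : Mor zob A), f = 0;
  zob_terminal : forall (A : Ob) (f : Mor A zob), f = 0;
  dsum : Ob -> Ob -> Ob;
  in1 : forall A B : Ob, Mor A (dsum A B);
  in2 : forall A B : Ob, Mor B (dsum A B);
  pr1 : forall A B : Ob, Mor (dsum A B) A;
  pr2 : forall A B : Ob, Mor (dsum A B) B;
  pr1_in1 : forall A B : Ob, pr1 A B \oc in1 A B = idm A;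
  pr2_in2 : forall A B : Ob, pr2 A B \oc in2 A B = idm B;
  pr1_in2 : forall A B : Ob, pr1 A B \oc in2 A B = 0;
  pr2_in1 : forall A B : Ob, pr2 A B \oc in1 A B = 0;
  dsum_id : forall A B : Ob,
    in1 A B \oc pr1 A B + in2 A B \oc pr2 A B = idm (dsum A B)
}.

Arguments Mor {a} _ _.
Arguments idm {a} _.
Arguments compm {a A B C} _ _.
Arguments dsum {a} _ _.
Arguments in1 {a} _ _.
Arguments in2 {a} _ _.
Arguments pr1 {a} _ _.
Arguments pr2 {a} _ _.

Notation "g \oc f" := (compm g f) : cat_scope.
Local Open Scope cat_scope.

Definition is_iso (K : addCat) (A B : K) (f : Mor A B) : Prop :=
  exists g : Mor B A, g \oc f = idm A /\ f \oc g = idm B.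

Definition dsum_mor (K : addCat) (A A' B B' : K)
    (f : Mor A B) (f' : Mor A' B') : Mor (dsum A A') (dsum B B') :=
  in1 B B' \oc f \oc pr1 A A' + in2 B B' \oc f' \oc pr2 A A'.

(** * Extensions and realizations *)

(* A biadditive functor K^op x K -> Ab: [push a] is a_* and [pull c] is c^*. *)
Record extFunctor (K : addCat) := ExtFunctor {
  Ext :> K -> K -> zmodType;
  push : forall C A A' : K, Mor A A' -> Ext C A -> Ext C A';
  pull : forall C C' A : K, Mor C' C -> Ext C A -> Ext C' A;
  push1 : forall (C A : K) (d : Ext C A), push (idm A) d = d;
  pushM : forall (C A A' A'' : K) (a' : Mor A' A'') (a : Mor A A')
    (d : Ext C A), push (a' \oc a) d = push a' (push a d);
  pull1 : forall (C A : K) (d : Ext C A), pull (idm C) d = d;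
  pullM : forall (C C' C'' A : K) (c : Mor C' C) (c' : Mor C'' C')
    (d : Ext C A), pull (c \oc c') d = pull c' (pull c d);
  push_pull : forall (C C' A A' : K) (a : Mor A A') (c : Mor C' C)
    (d : Ext C A), push a (pull c d) = pull c (push a d);
  pushDr : forall (C A A' : K) (a : Mor A A') (d d' : Ext C A),
    push a (d + d') = push a d + push a d';
  pullDr : forall (C C' A : K) (c : Mor C' C) (d d' : Ext C A),
    pull c (d + d') = pull c d + pull c d';
  pushDl : forall (C A A' : K) (a a' : Mor A A') (d : Ext C A),
    push (a + a') d = push a d + push a' d;
  pullDl : forall (C C' A : K) (c c' : Mor C' C) (d : Ext C A),
    pull (c + c') d = pull c d + pull c' d
}.

Arguments push {K e C A A'} _ _.
Arguments pull {K e C C' A} _ _.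

(* The element of E(C + C', A + A') corresponding to (d, 0, 0, d') in
   E(C, A) + E(C, A') + E(C', A) + E(C', A'). *)
Definition dsum_ext (K : addCat) (E : extFunctor K) (A A' C C' : K)
    (d : E C A) (d' : E C' A') : E (dsum C C') (dsum A A') :=
  push (in1 A A') (pull (pr1 C C') d) + push (in2 A A') (pull (pr2 C C') d').

Record sequence (K : addCat) (A C : K) := Sequence {
  mid : K;
  sfst : Mor A mid;
  ssnd : Mor mid C
}.

Arguments Sequence {K A C mid} _ _.

Definition seq_equiv (K : addCat) (A C : K) (u v : sequence A C) : Prop :=
  exists b : Mor (mid u) (mid v),
    [/\ is_iso b, b \oc sfst u = sfst v & ssnd v \oc b = ssnd u].

Definition split_seq (K : addCat) (A C : K) : sequence A C :=
  Sequence (in1 A C) (pr2 A C).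

Definition dsum_seq (K : addCat) (A C A' C' : K)
    (u : sequence A C) (u' : sequence A' C') :
    sequence (dsum A A') (dsum C C') :=
  Sequence (dsum_mor (sfst u) (sfst u')) (dsum_mor (ssnd u) (ssnd u')).

(* Equivalence classes are encoded as predicates: [s d u] means that u lies in s(d), so
   that under [real_class] membership in s(d) is the same as s(d) = [u]. *)
Definition realizer (K : addCat) (E : extFunctor K) :=
  forall A C : K, E C A -> sequence A C -> Prop.

Record additive_realization (K : addCat) (E : extFunctor K)
    (s : realizer E) : Prop := AdditiveRealization {
  real_class : forall (A C : K) (d : E C A),
    exists u : sequence A C,
      forall v : sequence A C, s A C d v <-> seq_equiv u v;
  real_lift : forall (A C A' C' : K) (d : E C A) (d' : E C' A')
    (u : sequence A C) (u' : sequence A' C') (a : Mor A A') (c : Mor C C'),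
    s A C d u -> s A' C' d' u' -> push a d = pull c d' ->
    exists b : Mor (mid u) (mid u'),
      b \oc sfst u = sfst u' \oc a /\ c \oc ssnd u = ssnd u' \oc b;
  real0 : forall A C : K, s A C 0 (split_seq A C);
  real_dsum : forall (A C A' C' : K) (d : E C A) (d' : E C' A')
    (u : sequence A C) (u' : sequence A' C'),
    s A C d u -> s A' C' d' u' ->
    s (dsum A A') (dsum C C') (dsum_ext d d') (dsum_seq u u')
}.

(** * Extriangulated categories *)

Section ET.
Variables (K : addCat) (E : extFunctor K) (s : realizer E).

Local Notation triangle x y d := (s d (Sequence x y)).

Definition ET3 : Prop :=
  forall (A B C A' B' C' : K) (x : Mor A B) (y : Mor B C) (d : E C A)
    (x' : Mor A' B') (y' : Mor B' C') (d' : E C' A')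
    (a : Mor A A') (b : Mor B B'),
  triangle x y d -> triangle x' y' d' -> b \oc x = x' \oc a ->
  exists c : Mor C C', c \oc y = y' \oc b /\ push a d = pull c d'.

Definition ET3op : Prop :=
  forall (A B C A' B' C' : K) (x : Mor A B) (y : Mor B C) (d : E C A)
    (x' : Mor A' B') (y' : Mor B' C') (d' : E C' A')
    (b : Mor B B') (c : Mor C C'),
  triangle x y d -> triangle x' y' d' -> c \oc y = y' \oc b ->
  exists a : Mor A A', b \oc x = x' \oc a /\ push a d = pull c d'.

Definition ET4 : Prop :=
  forall (A B C D F : K)
    (f : Mor A B) (f' : Mor B D) (d1 : E D A)
    (g : Mor B C) (g' : Mor C F) (d2 : E F B),
  triangle f f' d1 -> triangle g g' d2 ->
  exists (Z : K) (h' : Mor C Z) (d : Mor D Z) (e : Mor Z F) (d3 : E Z A),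
    [/\ h' \oc g = d \oc f' /\ e \oc h' = g',
        triangle (g \oc f) h' d3,
        triangle d e (push f' d2),
        pull d d3 = d1
      & push f d3 = pull e d2].

Definition ET4op : Prop :=
  forall (A B C D F : K)
    (f : Mor B A) (f' : Mor D B) (d1 : E A D)
    (g : Mor C B) (g' : Mor F C) (d2 : E B F),
  triangle f' f d1 -> triangle g' g d2 ->
  exists (Z : K) (h' : Mor Z C) (d : Mor Z D) (e : Mor F Z) (d3 : E A Z),
    [/\ g \oc h' = f' \oc d /\ h' \oc e = g',
        triangle h' (f \oc g) d3,
        triangle e d (pull f' d2),
        push d d3 = d1
      & pull f d3 = push e d2].

End ET.

Record extriCat := ExtriCat {
  ecat :> addCat;
  extE : extFunctor ecat;
  realizes : realizer extE;
  extri_ET2 : additive_realization realizes;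
  extri_ET3 : ET3 realizes;
  extri_ET3op : ET3op realizes;
  extri_ET4 : ET4 realizes;
  extri_ET4op : ET4op realizes
}.

Arguments extE {e} : rename.
Arguments realizes {e A C} _ _ : rename.

Section Triangles.
Variable K : extriCat.

Local Notation E := (@extE K).

Definition etriangle (A B C : K) (x : Mor A B) (y : Mor B C) (d : E C A) :
  Prop := realizes d (Sequence x y).

Definition inflation (A B : K) (x : Mor A B) : Prop :=
  exists (C : K) (y : Mor B C) (d : E C A), etriangle x y d.

Definition deflation (B C : K) (y : Mor B C) : Prop :=
  exists (A : K) (x : Mor A B) (d : E C A), etriangle x y d.

Definition WIC : Prop :=
  (forall (A B C : K) (f : Mor A B) (g : Mor B C),
     inflation (g \oc f) -> inflation f) /\
  (forall (A B C : K) (f : Mor A B) (g : Mor B C),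
     deflation (g \oc f) -> deflation g).

Definition iso_triangles (A B C A' B' C' : K)
    (x : Mor A B) (y : Mor B C) (d : E C A)
    (x' : Mor A' B') (y' : Mor B' C') (d' : E C' A') : Prop :=
  exists (a : Mor A A') (b : Mor B B') (c : Mor C C'),
    [/\ is_iso a, is_iso b & is_iso c] /\
    [/\ b \oc x = x' \oc a, c \oc y = y' \oc b & push a d = pull c d'].

Definition tri_class : Type :=
  forall A B C : K, Mor A B -> Mor B C -> E C A -> Prop.

Section Class.
Variable xi : tri_class.

(* The empty coproduct 0 -> 0 -> 0 is split, so binary coproducts suffice in
   [proper_dsum]. *)
Record proper_class : Prop := ProperClass {
  proper_tri : forall (A B C : K) (x : Mor A B) (y : Mor B C) (d : E C A),
    xi x y d -> etriangle x y d;
  proper_iso : forall (A B C A' B' C' : K)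
    (x : Mor A B) (y : Mor B C) (d : E C A)
    (x' : Mor A' B') (y' : Mor B' C') (d' : E C' A'),
    xi x y d -> etriangle x' y' d' -> iso_triangles x y d x' y' d' ->
    xi x' y' d';
  proper_dsum : forall (A B C A' B' C' : K)
    (x : Mor A B) (y : Mor B C) (d : E C A)
    (x' : Mor A' B') (y' : Mor B' C') (d' : E C' A'),
    xi x y d -> xi x' y' d' ->
    xi (dsum_mor x x') (dsum_mor y y') (dsum_ext d d');
  proper_split : forall (A B C : K) (x : Mor A B) (y : Mor B C),
    etriangle x y (0 : E C A) -> xi x y (0 : E C A);
  proper_base : forall (A B C B' C' : K)
    (x : Mor A B) (y : Mor B C) (d : E C A)
    (c : Mor C' C) (x' : Mor A B') (y' : Mor B' C'),
    xi x y d -> etriangle x' y' (pull c d) -> xi x' y' (pull c d);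
  proper_cobase : forall (A B C A' B' : K)
    (x : Mor A B) (y : Mor B C) (d : E C A)
    (a : Mor A A') (x' : Mor A' B') (y' : Mor B' C),
    xi x y d -> etriangle x' y' (push a d) -> xi x' y' (push a d);
  proper_saturated : forall (A1 B1 A2 B2 C M : K)
    (x1 : Mor A1 B1) (y1 : Mor B1 C) (d1 : E C A1)
    (x2 : Mor A2 B2) (y2 : Mor B2 C) (d2 : E C A2)
    (m : Mor A1 M) (n : Mor M B2),
    etriangle x1 y1 d1 -> xi x2 y2 d2 -> xi m n (pull y2 d1) ->
    xi x1 y1 d1
}.

Definition xi_inflation (A B : K) (x : Mor A B) : Prop :=
  exists (C : K) (y : Mor B C) (d : E C A), xi x y d.

Definition short_exact (U V W : zmodType) (f : U -> V) (g : V -> W) : Prop :=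
  [/\ injective f,
      forall v : V, g v = 0 <-> exists u : U, f u = v
    & forall w : W, exists v : V, g v = w].

Definition contra_exact (A B C : K) (x : Mor A B) (y : Mor B C) (I : K) :
    Prop :=
  short_exact (fun h : Mor C I => h \oc y) (fun h : Mor B I => h \oc x).

Definition co_exact (A B C : K) (x : Mor A B) (y : Mor B C) (P : K) : Prop :=
  short_exact (fun h : Mor P A => x \oc h) (fun h : Mor P B => y \oc h).

Definition xi_injective (I : K) : Prop :=
  forall (A B C : K) (x : Mor A B) (y : Mor B C) (d : E C A),
    xi x y d -> contra_exact x y I.

Definition xi_projective (P : K) : Prop :=
  forall (A B C : K) (x : Mor A B) (y : Mor B C) (d : E C A),
    xi x y d -> co_exact x y P.

Definition enough_injectives : Prop :=
  forall A : K, exists (I N : K) (x : Mor A I) (y : Mor I N) (d : E N A),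
    xi_injective I /\ xi x y d.

Definition enough_projectives : Prop :=
  forall A : K, exists (N P : K) (x : Mor N P) (y : Mor P A) (d : E A N),
    xi_projective P /\ xi x y d.

Definition quasi_xi_injective (Q : K) : Prop :=
  forall (A B : K) (x : Mor A Q) (y : Mor Q B) (d : E B A),
    xi x y d -> contra_exact x y Q.

Definition essential (A B : K) (f : Mor A B) : Prop :=
  xi_inflation f /\
  forall (C : K) (g : Mor B C), xi_inflation (g \oc f) -> xi_inflation g.

Definition injective_envelope (A X : K) (f : Mor A X) : Prop :=
  essential f /\ xi_injective X.

Definition quasi_injective_envelope (A X : K) (f : Mor A X) : Prop :=
  essential f /\ quasi_xi_injective X.

End Class.
End Triangles.

Arguments WIC K : clear implicits.

(* Main.v *)
Require Import Defs.
From mathcomp Require Import all_boot ssralg.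

(** For the direction from quasi-[xi]-injective to [xi]-injective envelopes, embed
    [A] in a [xi]-injective [I] by [j], and let [f : A + I -> Q] be a
    quasi-[xi]-injective envelope. As [I] is [xi]-injective and (WIC) holds, [Q]
    splits as [Q' + I] with [f] becoming [f' + 1], and [f' : A -> Q'] inherits
    essentiality from [f]. Hence [j] extends along [f'] to a [xi]-inflation
    [k : Q' -> I], and quasi-injectivity of [Q' + I] makes [k] a split
    monomorphism. So [Q'] is a retract of [I], and [f'] is a [xi]-injective
    envelope of [A]. *)

Set Implicit Arguments.
Unset Strict Implicit.
Unset Printing Implicit Defensive.

Import GRing.Theory.
Local Open Scope ring_scope.
Local Open Scope cat_scope.

(** * Elementary consequences of additivity *)

Lemma additive0 (U V : zmodType) (h : U -> V) :
  (forall u v, h (u + v) = h u + h v) -> h 0 = 0.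
Proof. by move=> hD; apply: (addrI (h 0)); rewrite -hD !addr0. Qed.

Section AdditiveCategory.
Variable K : addCat.

Lemma comp0m (A B C : K) (f : Mor A B) : (0 : Mor B C) \oc f = 0.
Proof. exact: (additive0 (fun g g' => compmDl g g' f)). Qed.

Lemma compm0 (A B C : K) (g : Mor B C) : g \oc (0 : Mor A B) = 0.
Proof. exact: (additive0 (compmDr g)). Qed.

Lemma compmBr (A B C : K) (g : Mor B C) (f f' : Mor A B) :
  g \oc (f - f') = g \oc f - g \oc f'.
Proof. by apply: (addIr (g \oc f')); rewrite -compmDr !subrK. Qed.

Lemma dsum_ext_mor (A B C : K) (g g' : Mor (dsum A B) C) :
  g \oc in1 A B = g' \oc in1 A B -> g \oc in2 A B = g' \oc in2 A B -> g = g'.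
Proof.
move=> g1 g2; rewrite -[g]compm1 -[g']compm1 -dsum_id.
by rewrite !compmDr !compmA g1 g2.
Qed.

Lemma is_iso_epi (A B C : K) (b : Mor A B) (g g' : Mor B C) :
  is_iso b -> g \oc b = g' \oc b -> g = g'.
Proof.
by case=> b' [_ bb'] gb; rewrite -[g]compm1 -[g']compm1 -bb' !compmA gb.
Qed.

End AdditiveCategory.

Section ExtFunctor.
Variables (K : addCat) (E : extFunctor K).

Lemma push0 (C A A' : K) (a : Mor A A') : push a (0 : E C A) = 0.
Proof. exact: (additive0 (pushDr a)). Qed.

Lemma pull0 (C C' A : K) (c : Mor C' C) : pull c (0 : E C A) = 0.
Proof. exact: (additive0 (pullDr c)). Qed.

End ExtFunctor.

(** * Realizing triangles and split monomorphisms *)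

Section ExtriangulatedCategory.
Variable K : extriCat.
Local Notation E := (@extE K).

Lemma realization_exists (A C : K) (d : E C A) :
  exists (B : K) (x : Mor A B) (y : Mor B C), etriangle x y d.
Proof.
have [[B x y] ud] := real_class (extri_ET2 K) d.
exists B, x, y; apply/ud; exists (idm B); split=> //=.
- by exists (idm B); rewrite comp1m.
- by rewrite comp1m.
- by rewrite compm1.
Qed.

Lemma etriangle_equiv (A C B B' : K) (d : E C A) (x : Mor A B) (y : Mor B C)
    (x' : Mor A B') (y' : Mor B' C) :
  etriangle x y d -> etriangle x' y' d ->
  exists b : Mor B B', [/\ is_iso b, b \oc x = x' & y' \oc b = y].
Proof.
have [u ud] := real_class (extri_ET2 K) d.
move=> /ud[b [[bi [bib bbi]] bx yb]] /ud[b' [[bi' [bib' bbi']] bx' yb']] /=.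
rewrite /= in b bi bib bbi bx yb b' bi' bib' bbi' bx' yb'.
exists (b' \oc bi); split.
- exists (b \oc bi'); split.
    by rewrite -compmA [bi' \oc _]compmA bib' comp1m.
  by rewrite -compmA [bi \oc _]compmA bib comp1m.
- by rewrite -bx -compmA [bi \oc _]compmA bib comp1m.
- by rewrite compmA yb' -yb -compmA bbi compm1.
Qed.

(** The split sequence of [A] and the zero object is transported along [pr1], which is invertible
    because the second summand vanishes. *)
Lemma etriangle_idm (A : K) :
  etriangle (idm A) (0 : Mor A (zob K)) (0 : E (zob K) A).
Proof.
have [u ud] := real_class (extri_ET2 K) (0 : E (zob K) A).
have [b [[bi [bib bbi]] bx yb]] := (ud _).1 (real0 (extri_ET2 K) A (zob K)).
rewrite /= in b bi bib bbi bx yb.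
have in1K : in1 A (zob K) \oc pr1 A (zob K) = idm _.
  rewrite -[RHS]dsum_id.
  by rewrite [pr2 _ _]zob_terminal compm0 addr0.
apply/ud; exists (pr1 A (zob K) \oc b); split=> /=.
- exists (bi \oc in1 A (zob K)); split.
    by rewrite -compmA [in1 _ _ \oc _]compmA in1K comp1m.
  by rewrite -compmA [b \oc _]compmA bbi comp1m pr1_in1.
- by rewrite -compmA bx pr1_in1.
- by rewrite comp0m [RHS]zob_terminal.
Qed.

(** (ET3), applied to the square from the given triangle to the trivial one on [B], makes this
    extension a pullback of 0. *)
Lemma push_inflation (A B C : K) (x : Mor A B) (y : Mor B C) (d : E C A) :
  etriangle x y d -> push x d = 0.
Proof.
move=> xyd; have sq : idm B \oc x = idm B \oc x by [].
have [c [_ ->]] := extri_ET3 xyd (etriangle_idm B) sq.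
exact: pull0.
Qed.

(* Idempotent splitting: (WIC) turns a split monomorphism into an inflation, whose
   extension vanishes, so that it has a complement. *)
Lemma split_mono_complement (hWIC : WIC K) (I Q : K) (i : Mor I Q)
    (r : Mor Q I) :
  r \oc i = idm I ->
  exists (X : K) (q : Mor Q X) (s : Mor X Q),
    [/\ q \oc i = 0, r \oc s = 0, q \oc s = idm X
      & s \oc q + i \oc r = idm Q].
Proof.
move=> ri.
have infl_i : inflation i.
  apply: (hWIC.1 _ _ _ i r); rewrite ri.
  by exists (zob K), 0, 0; apply: etriangle_idm.
have [X [q [d iqd]]] := infl_i.
have d0 : d = 0 by rewrite -[d]push1 -ri pushM (push_inflation iqd) push0.
rewrite d0 in iqd.
have [b [isob bin1 qb]] := etriangle_equiv (real0 (extri_ET2 K) I X) iqd.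
pose s0 := b \oc in2 I X.
have qi : q \oc i = 0 by rewrite -bin1 compmA qb pr2_in1.
have qs0 : q \oc s0 = idm X by rewrite compmA qb pr2_in2.
(* The section [s0] of [q] need not be killed by [r]. The correction term achieves this because
   [r \oc i] is the identity, and it does not disturb the section property because [q \oc i = 0]. *)
exists X, q, (s0 - i \oc r \oc s0).
have qs : q \oc (s0 - i \oc r \oc s0) = idm X.
  by rewrite compmBr qs0 !compmA qi !comp0m subr0.
split=> //; first by rewrite compmBr !compmA ri comp1m subrr.
(* The decomposition of the identity of [Q] is checked on the two summands after precomposing with
   [b]. *)
apply: (is_iso_epi isob); apply: dsum_ext_mor.
  rewrite -!compmA bin1 compmDl -!compmA qi ri.
  by rewrite compm0 add0r compm1 comp1m.
rewrite -!compmA -/s0 compmDl -!compmA qs0 compm1 comp1m.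
by rewrite subrK.
Qed.

(** * Stability properties of [xi]-inflations *)

Section ProperClass.
Hypothesis hWIC : WIC K.
Variable xi : tri_class K.
Hypothesis hxi : proper_class xi.

Lemma xi_inflation_idm (A : K) : xi_inflation xi (idm A).
Proof.
by exists (zob K), 0, 0; apply: (proper_split hxi); apply: etriangle_idm.
Qed.

(* By (ET3), the extension of [f] is a base change of the one of [g \oc f]. *)
Lemma xi_inflation_cancel (A B C : K) (f : Mor A B) (g : Mor B C) :
  xi_inflation xi (g \oc f) -> xi_inflation xi f.
Proof.
move=> [Z [h [d gfhd]]]; have tri_gf := proper_tri hxi gfhd.
have [D [f' [d' tri_f]]] : inflation f.
  by apply: (hWIC.1 _ _ _ f g); exists Z, h, d.
have sq : g \oc f = (g \oc f) \oc idm A by rewrite compm1.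
have [c [_ dE]] := extri_ET3 tri_f tri_gf sq.
rewrite push1 in dE; rewrite dE in tri_f.
by exists D, f', (pull c d); apply: (proper_base hxi) gfhd tri_f.
Qed.

(* The cobase change [m] of [f] along [q] satisfies [m = b \oc (f \oc s)]. *)
Lemma xi_inflation_comp_split (A B C : K) (s : Mor A B) (q : Mor B A)
    (f : Mor B C) :
  q \oc s = idm A -> xi_inflation xi f -> xi_inflation xi (f \oc s).
Proof.
move=> qs [D [f' [d ff'd]]].
have [M [m [n mn]]] := realization_exists (push q d).
have sq : push q d = pull (idm D) (push q d) by rewrite pull1.
have [b [bf _]] :=
  real_lift (extri_ET2 K) (proper_tri hxi ff'd) mn sq.
rewrite /= in b bf.
apply: (xi_inflation_cancel (g := b)).
rewrite compmA bf -compmA qs compm1.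
by exists D, n, (push q d); apply: (proper_cobase hxi) ff'd mn.
Qed.

Lemma xi_inflation_dsum (A B A' B' : K) (x : Mor A B) (x' : Mor A' B') :
  xi_inflation xi x -> xi_inflation xi x' -> xi_inflation xi (dsum_mor x x').
Proof.
move=> [C [y [d xyd]]] [C' [y' [d' xyd']]].
by exists (dsum C C'), (dsum_mor y y'), (dsum_ext d d'); apply: proper_dsum.
Qed.

(** * Injective objects and essential [xi]-inflations *)

Lemma xi_injective_extend (I A B : K) (x : Mor A B) (a : Mor A I) :
  xi_injective xi I -> xi_inflation xi x ->
  exists b : Mor B I, b \oc x = a.
Proof. by move=> injI [C [y [d /injI[_ _]]]]; apply. Qed.

Lemma quasi_xi_injective_extend (Q A : K) (x : Mor A Q) (a : Mor A Q) :
  quasi_xi_injective xi Q -> xi_inflation xi x ->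
  exists b : Mor Q Q, b \oc x = a.
Proof. by move=> injQ [C [y [d /injQ[_ _]]]]; apply. Qed.

(** Composition with [k] and [p] makes the Hom sequence into [X] a retract of the one into [I], and
    exactness passes to retracts. *)
Lemma xi_injective_retract (X I : K) (k : Mor X I) (p : Mor I X) :
  p \oc k = idm X -> xi_injective xi I -> xi_injective xi X.
Proof.
move=> pk injI A B C x y d /injI[injy exI surj].
have kK (Z : K) (h : Mor Z X) : p \oc (k \oc h) = h.
  by rewrite compmA pk comp1m.
split=> [h h' hy | h | h].
- rewrite -[h]kK -[h']kK; congr (_ \oc _); apply: injy.
  by rewrite -!compmA hy.
- split=> [hx0 | [u <-]].
    have [|u uy] := (exI (k \oc h)).1; first by rewrite -compmA hx0 compm0.
    by exists (p \oc u); rewrite -compmA uy kK.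
  have kuyx : k \oc (u \oc y) \oc x = 0.
    by apply/exI; exists (k \oc u); rewrite compmA.
  by rewrite -[LHS]kK [k \oc _]compmA kuyx compm0.
- have [v vx] := surj (k \oc h).
  by exists (p \oc v); rewrite -compmA vx kK.
Qed.

Lemma xi_injective_quasi (I : K) : xi_injective xi I -> quasi_xi_injective xi I.
Proof. by move=> injI A B x y d; apply: injI. Qed.

(** The hypotheses say that [s] and [f \oc in2 A I] identify [X + I] with [Q], with inverse given by
    [q] and [r], and that [f] becomes the sum of [q \oc f \oc in1 A I] and the identity of [I]. *)
Lemma essential_summand (A I Q X : K) (f : Mor (dsum A I) Q)
    (r : Mor Q I) (q : Mor Q X) (s : Mor X Q) :
  essential xi f -> r \oc f = pr2 A I -> q \oc f \oc in2 A I = 0 ->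
  r \oc s = 0 -> q \oc s = idm X ->
  s \oc q + f \oc in2 A I \oc r = idm Q ->
  essential xi (q \oc f \oc in1 A I).
Proof.
move=> [xf essf] rf qf2 rs qs sq1.
set f' := q \oc f \oc in1 A I.
have sf' : s \oc f' = f \oc in1 A I.
  rewrite -[RHS]comp1m -sq1 compmDl -!compmA [r \oc _]compmA rf pr2_in1.
  by rewrite !compm0 addr0 /f' -!compmA.
split.
  apply: (xi_inflation_cancel (g := s)); rewrite sf'.
  by apply: xi_inflation_comp_split xf; apply: pr1_in1.
move=> C g gf'.
(* In these coordinates [G] is [g + 1], so that [G \oc f] is the sum of [g \oc f'] and an identity.
   Essentiality of [f] then applies to [G], and restricting [G] along [s] recovers [g] up to
   [in1 C I]. *)
pose G := in1 C I \oc g \oc q + in2 C I \oc r.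
have Gf : G \oc f = dsum_mor (g \oc f') (idm I).
  apply: dsum_ext_mor; rewrite /G /dsum_mor !compmDl -!compmA.
    by rewrite [r \oc _]compmA rf pr1_in1 pr2_in1 !compm0 !addr0 compm1.
  rewrite [r \oc _]compmA rf pr1_in2 pr2_in2 [q \oc _]compmA qf2.
  by rewrite !compm0 !add0r comp1m.
have xG : xi_inflation xi G.
  apply: essf; rewrite Gf.
  by apply: xi_inflation_dsum => //; apply: xi_inflation_idm.
apply: (xi_inflation_cancel (g := in1 C I)).
have <- : G \oc s = in1 C I \oc g.
  by rewrite compmDl -!compmA rs qs compm0 addr0 compm1.
exact: xi_inflation_comp_split qs xG.
Qed.

Lemma injective_envelope_of_quasi (A I : K) (j : Mor A I) (Q : K)
    (f : Mor (dsum A I) Q) :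
  xi_inflation xi j -> xi_injective xi I -> quasi_injective_envelope xi f ->
  exists (X : K) (f' : Mor A X), injective_envelope xi f'.
Proof.
move=> xj injI [essf quasiQ].
have [r rf] := xi_injective_extend (pr2 A I) injI essf.1.
have ri : r \oc (f \oc in2 A I) = idm I by rewrite compmA rf pr2_in2.
have [X [q [s [qi rs qs sq1]]]] := split_mono_complement hWIC ri.
rewrite compmA in qi.
have essf' := essential_summand essf rf qi rs qs sq1.
exists X, (q \oc f \oc in1 A I); split=> //.
have [k kf'] := xi_injective_extend j injI essf'.1.
have xk : xi_inflation xi k by apply: essf'.2; rewrite kf'.
have xik : xi_inflation xi (f \oc in2 A I \oc k).
  by apply: (xi_inflation_cancel (g := r)); rewrite compmA ri comp1m.
(* [X] is embedded in [Q] through the summand [I], by way of [k], and the other embedding [s] is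
   extended along it. Composing the extension with [q] gives a retraction of [k], since [q \oc s] is
   the identity. *)
have [t tik] := quasi_xi_injective_extend s quasiQ xik.
apply: (xi_injective_retract (k := k) (p := q \oc (t \oc (f \oc in2 A I)))) injI.
by rewrite -!compmA in tik *; rewrite tik.
Qed.

End ProperClass.
End ExtriangulatedCategory.

Theorem theorem3p15 (K : extriCat) (hWIC : WIC K)
    (xi : tri_class K) (hxi : proper_class xi)
    (hproj : enough_projectives xi) (hinj : enough_injectives xi) :
  (forall A : K, exists (X : K) (f : Mor A X), injective_envelope xi f) <->
  (forall A : K, exists (X : K) (f : Mor A X), quasi_injective_envelope xi f).
Proof.
split=> env A.
  have [X [f [essf injX]]] := env A.
  by exists X, f; split=> //; apply: xi_injective_quasi.
have [I [N [j [y [d [injI jyd]]]]]] := hinj A.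
have [Q [f envf]] := env (dsum A I).
apply: (injective_envelope_of_quasi hWIC hxi _ injI envf (j := j)).
by exists N, y, d.
Qed.
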